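(* Let $\mathcal L$ be a 2-di-exact 2-category. Let $p$ be a morphism of ladders from a ladder $(a,b,c,d,f,g,h,\phi,\psi)$ to a ladder $(a',b',c',d',f',g',h',\phi',\psi')$, where in both ladders the rows are 2-exact and the verticals are normal, and let $\partial\colon\mathrm{Ker}(h)\to\mathrm{Cok}(f)$, $\partial'\colon\mathrm{Ker}(h')\to\mathrm{Cok}(f')$ be their connecting 1-cells. Then $p$ induces 1-cells $$\bar p_A\colon\mathrm{Ker}(f)\to\mathrm{Ker}(f'),\quad \bar p_B\colon\mathrm{Ker}(g)\to\mathrm{Ker}(g'),\quad \bar p_C\colon\mathrm{Ker}(h)\to\mathrm{Ker}(h'),$$ $$\underline p_X\colon\mathrm{Cok}(f)\to\mathrm{Cok}(f'),\quad \underline p_Y\colon\mathrm{Cok}(g)\to\mathrm{Cok}(g'),\quad \underline p_Z\colon\mathrm{Cok}(h)\to\mathrm{Cok}(h')$$ on 2-kernels and 2-cokernels, and the resulting ladder between the snake sequences $$\mathrm{Ker}(f)\xrightarrow{\bar a}\mathrm{Ker}(g)\xrightarrow{\bar b}\mathrm{Ker}(h)\xrightarrow{\partial}\mathrm{Cok}(f)\xrightarrow{\underline c}\mathrm{Cok}(g)\xrightarrow{\underline d}\mathrm{Cok}(h)$$ and its primed counterpart commutes up to invertible 2-cells: $\bar p_B\circ\bar a\cong\bar a'\circ\bar p_A$, $\bar p_C\circ\bar b\cong\bar b'\circ\bar p_B$, $\underline p_X\circ\partial\cong\partial'\circ\bar p_C$, $\underline p_Y\circ\underline c\cong\underline c'\circ\underline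 p_X$, $\underline p_Z\circ\underline d\cong\underline d'\circ\underline p_Y$.
   Context: Basic notions. 2-categories are strict. For 1-cells, $\cong$ denotes (existence of) an invertible 2-cell; $\simeq$ denotes equivalence. Whiskering is denoted $\star$. A bizero object of $\mathcal L$ is an object $0$ such that for every $A$ the hom-categories $\mathcal L(A,0)$ and $\mathcal L(0,A)$ are equivalent to the terminal category. A 1-cell is null if it factors through $0$; $f\cong 0$ means $f$ is isomorphic to a null 1-cell. The bizero object is strong if between any two parallel 1-cells that factor through $0$ there is exactly one 2-cell. With a strong bizero object, a 2-kernel of $f\colon A\to B$ is a 1-cell $k\colon K\to A$ with $f\circ k\cong 0$ such that (1) for every $z\colon Z\to A$ with $f\circ z\cong0$ there is $u\colon Z\to K$ with $k\circ u\cong z$; (2) for all $u,v\colon Z\to K$ and every 2-cell $\lambda\colon k\circ u\Rightarrow k\circ v$ there is a unique 2-cell $\mu\colon u\Rightarrow v$ with $k\star\mu=\lambda$. 2-cokernels are dual. They are unique up to equivalence, written $\ker(f)\colon\mathrm{Ker}(f)\to A$, $\operatorname{coker}(f)\colon B\to\mathrm{Cok}(f)$. A normal 2-monomorphism (normal 2-epimorphism) is a 1-cell that is a 2-kernel (2-cokernel) of some 1-cell. A 1-cell $f$ is normal if $f\cong m\circ e$ with $e$ a normal 2-epimorphism and $m$ a normal 2-monomorphism; this normal image factorisation is unique up to equivalence, and we write $m=\mathrm{im}(f)\colon\mathrm{Im}(f)\to B$, $e=\mathrm{coim}(f)\colon A\to\mathrm{Im}(f)$. A 1-cell is antinormal if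 it is isomorphic to a normal 2-monomorphism followed by a normal 2-epimorphism. $\mathcal L$ is 2-di-exact if it has a strong bizero object, all 2-kernels and 2-cokernels, and every antinormal 1-cell is normal. A short 2-exact sequence is a composable pair $(k,q)$ with $k=\ker(q)$ and $q=\operatorname{coker}(k)$. A pair $(f,g)$ of composable normal 1-cells is 2-exact at the middle object if $\mathrm{im}(f)$ is a 2-kernel of $g$; a sequence is 2-exact if all its 1-cells are normal and it is 2-exact at every object with an incoming and an outgoing 1-cell. Ladders. A ladder consists of rows $A\xrightarrow{a}B\xrightarrow{b}C\to0$ and $0\to X\xrightarrow{c}Y\xrightarrow{d}Z$, verticals $f\colon A\to X$, $g\colon B\to Y$, $h\colon C\to Z$, and invertible 2-cells $\phi\colon g\circ a\cong c\circ f$, $\psi\colon h\circ b\cong d\circ g$. The 1-cells in its snake sequence satisfy $\ker(g)\bar a\cong a\ker(f)$, $\ker(h)\bar b\cong b\ker(g)$, $\underline c\operatorname{coker}(f)\cong\operatorname{coker}(g)c$, $\underline d\operatorname{coker}(g)\cong\operatorname{coker}(h)d$. A morphism of ladders $p$ consists of 1-cells $p_A,p_B,p_C,p_X,p_Y,p_Z$ from each object to its primed counterpart and invertible 2-cells $p_a\colon p_Ba\cong a'p_A$, $p_b\colon p_Cb\cong b'p_B$, $p_c\colon p_Yc\cong c'p_X$, $p_d\colon p_Zd\cong d'p_Y$, $p_f\colon p_Xf\cong f'p_A$, $p_g\colon p_Yg\cong g'p_B$, $p_h\colon p_Zh\cong h'p_C$, such that the two composites $p_Yga\cong p_Ycf\cong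 c'p_Xf\cong c'f'p_A$ (via $\phi,p_c,p_f$) and $p_Yga\cong g'p_Ba\cong g'a'p_A\cong c'f'p_A$ (via $p_g,p_a,\phi'$) are equal, and the two composites $p_Zhb\cong p_Zdg\cong d'p_Yg\cong d'g'p_B$ (via $\psi,p_d,p_g$) and $p_Zhb\cong h'p_Cb\cong h'b'p_B\cong d'g'p_B$ (via $p_h,p_b,\psi'$) are equal. The induced 1-cells satisfy $\ker(f')\bar p_A\cong p_A\ker(f)$, $\underline p_X\operatorname{coker}(f)\cong\operatorname{coker}(f')p_X$, and similarly for the others. Comparison. Given short 2-exact sequences $A_1\xrightarrow{a_1}Y_1\xrightarrow{b_1}C_1$ and $X_1\xrightarrow{c_1}Y_1\xrightarrow{d_1}Z_1$ with the same middle object, and $f_1\colon A_1\to X_1$, $h_1\colon C_1\to Z_1$ with $a_1\cong c_1f_1$, $h_1b_1\cong d_1$, there is (in a 2-di-exact 2-category) an equivalence $j\colon\mathrm{Cok}(f_1)\to\mathrm{Ker}(h_1)$, unique up to isomorphism, with $\ker(h_1)\circ j\circ\operatorname{coker}(f_1)\cong b_1\circ c_1$. The connecting 1-cell. First suppose that $a=\ker(b)$ and $d=\operatorname{coker}(c)$. (1) Let $b\circ\ker(g)\cong i\circ r$ be a normal image factorisation, $r\colon\mathrm{Ker}(g)\to I$, $i\colon I\to C$; let $\bar\imath\colon I\to\mathrm{Ker}(h)$ with $\ker(h)\bar\imath\cong i$, so that $\bar b\cong\bar\imath\circ r$ and $\mathrm{Cok}(\bar b)\simeq\mathrm{Cok}(\bar\imath)$;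 let $q=\operatorname{coker}(i)\colon C\to Q$ and $t\colon Q\to\mathrm{Im}(h)$ with $tq\cong\mathrm{coim}(h)$. The comparison for the rows $I\xrightarrow{i}C\xrightarrow{q}Q$ and $\mathrm{Ker}(h)\to C\xrightarrow{\mathrm{coim}(h)}\mathrm{Im}(h)$ with verticals $\bar\imath,t$ gives $z_1\colon\mathrm{Cok}(\bar b)\simeq\mathrm{Ker}(t)$. (2) Dually, let $\operatorname{coker}(g)\circ c\cong j_0\circ r_0$ be a normal image factorisation, $r_0\colon X\to J$, $j_0\colon J\to\mathrm{Cok}(g)$; let $\underline r\colon\mathrm{Cok}(f)\to J$ with $\underline r\operatorname{coker}(f)\cong r_0$, so that $\underline c\cong j_0\circ\underline r$ and $\mathrm{Ker}(\underline c)\simeq\mathrm{Ker}(\underline r)$; let $\kappa=\ker(r_0)\colon K\to X$ and $s\colon\mathrm{Im}(f)\to K$ with $\kappa s\cong\mathrm{im}(f)$. The comparison for the rows $\mathrm{Im}(f)\to X\to\mathrm{Cok}(f)$ and $K\xrightarrow{\kappa}X\xrightarrow{r_0}J$ with verticals $s,\underline r$ gives $z_3\colon\mathrm{Cok}(s)\simeq\mathrm{Ker}(\underline c)$. (3) The rows $\mathrm{Im}(f)\xrightarrow{\ell}\mathrm{Im}(g)\xrightarrow{\varpi}Q$ and $K\xrightarrow{\ell'}\mathrm{Im}(g)\xrightarrow{\varpi'}\mathrm{Im}(h)$, where $\ell\,\mathrm{coim}(f)\cong\mathrm{coim}(g)a$, $\varpi\,\mathrm{coim}(g)\cong qb$,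 $\mathrm{im}(g)\ell'\cong c\kappa$, $\mathrm{im}(h)\varpi'\cong d\,\mathrm{im}(g)$, are short 2-exact, and with verticals $s,t$ their comparison is an equivalence $z_2\colon\mathrm{Cok}(s)\to\mathrm{Ker}(t)$. Choosing a quasi-inverse $z_2^{-1}$, put $z=z_3z_2^{-1}z_1$ and $\partial=\ker(\underline c)\circ z\circ\operatorname{coker}(\bar b)$; it is well defined up to an invertible 2-cell. In general, take normal image factorisations $a\cong a_0\circ\mathrm{coim}(a)$ and $d\cong\mathrm{im}(d)\circ d_0$, let $f_0\colon\mathrm{Im}(a)\to X$ with $f_0\,\mathrm{coim}(a)\cong f$ and $h_0\colon C\to\mathrm{Im}(d)$ with $\mathrm{im}(d)h_0\cong h$; the connecting 1-cell of the given ladder is that of the special ladder with rows $(a_0,b)$, $(c,d_0)$ and verticals $f_0,g,h_0$, transported along the canonical equivalences $\mathrm{Ker}(h_0)\simeq\mathrm{Ker}(h)$ (over $C$) and $\mathrm{Cok}(f_0)\simeq\mathrm{Cok}(f)$ (under $X$). *)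

(* Defs.v *)
Set Implicit Arguments.
Unset Strict Implicit.
Unset Printing Implicit Defensive.

Declare Scope twocat_scope.
Delimit Scope twocat_scope with tc.
Open Scope twocat_scope.

Reserved Notation "g ∘ f" (at level 41, right associativity).
Reserved Notation "x ;; y" (at level 50, left associativity).
Reserved Notation "k ▷ m" (at level 38, no associativity).
Reserved Notation "m ◁ k" (at level 38, no associativity).
Reserved Notation "f ≅ g" (at level 70, no associativity).

(* Composition of arrows is written in diagrammatic order: [x ;; y] is
   "first [x], then [y]". *)
Record Category := {
  cat_ob :> Type;
  arr : cat_ob -> cat_ob -> Type;
  idarr : forall x, arr x x;
  then_ : forall x y z, arr x y -> arr y z -> arr x z;
  then_id_l : forall x y (u : arr x y), then_ (idarr x) u = u;
  then_id_r : forall x y (u : arr x y), then_ u (idarr y) = u;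
  then_assoc : forall x y z w (u : arr x y) (v : arr y z) (k : arr z w),
    then_ u (then_ v k) = then_ (then_ u v) k
}.
Arguments arr {c} x y.
Arguments idarr {c} x.

Notation "x ;; y" := (then_ x y) : twocat_scope.

Definition is_iso (C : Category) (x y : C) (u : arr x y) : Prop :=
  exists v : arr y x, u ;; v = idarr x /\ v ;; u = idarr y.

Record Iso (C : Category) (x y : C) := {
  iso_arr :> arr x y;
  iso_is_iso : is_iso iso_arr
}.

Definition isomorphic (C : Category) (x y : C) : Prop :=
  exists u : arr x y, is_iso u.

Notation "f ≅ g" := (isomorphic f g) : twocat_scope.

Record Functor (C D : Category) := {
  fob :> C -> D;
  fmap : forall x y, arr x y -> arr (fob x) (fob y);
  fmap_id : forall x, fmap (idarr x) = idarr (fob x);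
  fmap_then : forall x y z (u : arr x y) (v : arr y z),
    fmap (u ;; v) = fmap u ;; fmap v
}.
Arguments fmap {C D} f {x y} u.

Definition functor_id (C : Category) : Functor C C :=
  {| fob := fun x => x;
     fmap := fun _ _ u => u;
     fmap_id := fun _ => eq_refl;
     fmap_then := fun _ _ _ _ _ => eq_refl |}.

Definition functor_comp (C D E : Category) (G : Functor D E) (F : Functor C D) :
  Functor C E.
Proof.
  refine {| fob := fun x => G (F x);
            fmap := fun _ _ u => fmap G (fmap F u) |}.
  - intros x; rewrite fmap_id; apply fmap_id.
  - intros x y z u v; rewrite fmap_then; apply fmap_then.
Defined.

Definition naturally_isomorphic (C D : Category) (F G : Functor C D) : Prop :=
  exists eta : forall x, Iso (F x) (G x),
    forall x y (u : arr x y), fmap F u ;; eta y = eta x ;; fmap G u.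

Definition equivalent_categories (C D : Category) : Prop :=
  exists (F : Functor C D) (G : Functor D C),
    naturally_isomorphic (functor_comp G F) (functor_id C) /\
    naturally_isomorphic (functor_comp F G) (functor_id D).

Definition terminal_category : Category.
Proof.
  refine {| cat_ob := unit; arr := fun _ _ => unit; idarr := fun _ => tt;
            then_ := fun _ _ _ _ _ => tt |}.
  - intros x y []; reflexivity.
  - intros x y []; reflexivity.
  - reflexivity.
Defined.

Definition id_to_arr (C : Category) (x y : C) (e : x = y) : arr x y :=
  match e in _ = z return arr x z with eq_refl => idarr x end.

(* 1-cells are the objects, and 2-cells the arrows, of the hom-categories.
   Composition of 1-cells is associative and unital on the nose; the
   corresponding laws for 2-cells relate cells whose boundaries are only
   propositionally equal, and are stated by conjugating with the 2-cells
   [id_to_arr] induced by these equalities. *)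
Record TwoCategory := {
  ob :> Type;
  hom : ob -> ob -> Category;
  id1 : forall A, hom A A;
  comp1 : forall A B C, hom B C -> hom A B -> hom A C;
  hcomp : forall A B C (g g' : hom B C) (f f' : hom A B),
    arr g g' -> arr f f' -> arr (comp1 g f) (comp1 g' f');
  hcomp_idarr : forall A B C (g : hom B C) (f : hom A B),
    hcomp (idarr g) (idarr f) = idarr (comp1 g f);
  interchange : forall A B C (g g' g'' : hom B C) (f f' f'' : hom A B)
      (be : arr g g') (be' : arr g' g'') (al : arr f f') (al' : arr f' f''),
    hcomp (be ;; be') (al ;; al') = hcomp be al ;; hcomp be' al';
  comp1_assoc : forall A B C D (h : hom C D) (g : hom B C) (f : hom A B),
    comp1 h (comp1 g f) = comp1 (comp1 h g) f;
  comp1_id_l : forall A B (f : hom A B), comp1 (id1 B) f = f;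
  comp1_id_r : forall A B (f : hom A B), comp1 f (id1 A) = f;
  hcomp_assoc : forall A B C D (h h' : hom C D) (g g' : hom B C)
      (f f' : hom A B) (ga : arr h h') (be : arr g g') (al : arr f f'),
    hcomp ga (hcomp be al) ;; id_to_arr (comp1_assoc h' g' f') =
    id_to_arr (comp1_assoc h g f) ;; hcomp (hcomp ga be) al;
  hcomp_id_l : forall A B (f f' : hom A B) (al : arr f f'),
    hcomp (idarr (id1 B)) al ;; id_to_arr (comp1_id_l f') =
    id_to_arr (comp1_id_l f) ;; al;
  hcomp_id_r : forall A B (f f' : hom A B) (al : arr f f'),
    hcomp al (idarr (id1 A)) ;; id_to_arr (comp1_id_r f') =
    id_to_arr (comp1_id_r f) ;; al
}.
Arguments hom {t} A B.
Arguments id1 {t} A.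

Notation "g ∘ f" := (comp1 g f) : twocat_scope.
Notation "k ▷ m" := (hcomp (idarr k) m) : twocat_scope.
Notation "m ◁ k" := (hcomp m (idarr k)) : twocat_scope.

Section OneCells.
Variable L : TwoCategory.

Definition assoc_l (A B C D : L) (h : hom C D) (g : hom B C) (f : hom A B) :
  arr (h ∘ (g ∘ f)) ((h ∘ g) ∘ f) := id_to_arr (comp1_assoc h g f).

Definition assoc_r (A B C D : L) (h : hom C D) (g : hom B C) (f : hom A B) :
  arr ((h ∘ g) ∘ f) (h ∘ (g ∘ f)) := id_to_arr (eq_sym (comp1_assoc h g f)).

Definition quasi_inverse (A B : L) (j : hom A B) (k : hom B A) : Prop :=
  j ∘ k ≅ id1 B /\ k ∘ j ≅ id1 A.

Definition is_equivalence (A B : L) (j : hom A B) : Prop :=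
  exists k : hom B A, quasi_inverse j k.

End OneCells.

Section Exactness.
Variables (L : TwoCategory) (O : L).

Definition is_bizero : Prop :=
  forall A : L, equivalent_categories (hom A O) terminal_category /\
                equivalent_categories (hom O A) terminal_category.

Definition is_null (A B : L) (f : hom A B) : Prop :=
  exists (u : hom A O) (v : hom O B), f = v ∘ u.

Definition is_zero (A B : L) (f : hom A B) : Prop :=
  exists n : hom A B, is_null n /\ f ≅ n.

Definition is_strong : Prop :=
  forall (A B : L) (f g : hom A B), is_null f -> is_null g ->
    exists! al : arr f g, True.

Record is_kernel (A B : L) (f : hom A B) (K : L) (k : hom K A) : Prop := {
  kernel_zero : is_zero (f ∘ k);
  kernel_lift : forall (Z : L) (z : hom Z A), is_zero (f ∘ z) ->
    exists u : hom Z K, k ∘ u ≅ z;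
  kernel_lift2 : forall (Z : L) (u v : hom Z K) (la : arr (k ∘ u) (k ∘ v)),
    exists! mu : arr u v, k ▷ mu = la
}.

Record is_cokernel (A B : L) (f : hom A B) (Q : L) (q : hom B Q) : Prop := {
  cokernel_zero : is_zero (q ∘ f);
  cokernel_desc : forall (Z : L) (z : hom B Z), is_zero (z ∘ f) ->
    exists u : hom Q Z, u ∘ q ≅ z;
  cokernel_desc2 : forall (Z : L) (u v : hom Q Z) (la : arr (u ∘ q) (v ∘ q)),
    exists! mu : arr u v, mu ◁ q = la
}.

Definition normal_mono (K A : L) (m : hom K A) : Prop :=
  exists (B : L) (f : hom A B), is_kernel f m.

Definition normal_epi (B Q : L) (e : hom B Q) : Prop :=
  exists (A : L) (f : hom A B), is_cokernel f e.

(* [m] is (a representative of) im(f) and [e] of coim(f) *)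
Definition normal_image (A B : L) (f : hom A B)
    (I : L) (e : hom A I) (m : hom I B) : Prop :=
  normal_epi e /\ normal_mono m /\ f ≅ m ∘ e.

Definition normal (A B : L) (f : hom A B) : Prop :=
  exists (I : L) (e : hom A I) (m : hom I B), normal_image f e m.

Definition antinormal (A B : L) (f : hom A B) : Prop :=
  exists (M : L) (m : hom A M) (e : hom M B),
    normal_mono m /\ normal_epi e /\ f ≅ e ∘ m.

Record two_di_exact : Prop := {
  bizero : is_bizero;
  bizero_strong : is_strong;
  has_kernels : forall (A B : L) (f : hom A B),
    exists (K : L) (k : hom K A), is_kernel f k;
  has_cokernels : forall (A B : L) (f : hom A B),
    exists (Q : L) (q : hom B Q), is_cokernel f q;
  antinormal_normal : forall (A B : L) (f : hom A B), antinormal f -> normal f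
}.

Definition exact_at (A B C : L) (f : hom A B) (g : hom B C) : Prop :=
  normal f /\ normal g /\
  exists (I : L) (e : hom A I) (m : hom I B), normal_image f e m /\ is_kernel g m.

(* 2-exactness of A -> B -> C -> 0 and of 0 -> X -> Y -> Z; the 1-cells to and
   from the bizero object are unique up to a unique invertible 2-cell. *)
Definition right_exact_row (A B C : L) (a : hom A B) (b : hom B C) : Prop :=
  exists t : hom C O, exact_at a b /\ exact_at b t.

Definition left_exact_row (X Y Z : L) (c : hom X Y) (d : hom Y Z) : Prop :=
  exists t : hom O X, exact_at t c /\ exact_at c d.

End Exactness.

Record Ladder (L : TwoCategory) := {
  lA : L; lB : L; lC : L; lX : L; lY : L; lZ : L;
  la : hom lA lB;
  lb : hom lB lC;
  lc : hom lX lY;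
  ld : hom lY lZ;
  lf : hom lA lX;
  lg : hom lB lY;
  lh : hom lC lZ;
  lphi : Iso (lg ∘ la) (lc ∘ lf);
  lpsi : Iso (lh ∘ lb) (ld ∘ lg)
}.

Record exact_ladder (L : TwoCategory) (O : L) (D : Ladder L) : Prop := {
  top_row_exact : right_exact_row O (la D) (lb D);
  bottom_row_exact : left_exact_row O (lc D) (ld D);
  normal_f : normal O (lf D);
  normal_g : normal O (lg D);
  normal_h : normal O (lh D)
}.

Record LadderMorphism (L : TwoCategory) (D D' : Ladder L) := {
  pA : hom (lA D) (lA D');
  pB : hom (lB D) (lB D');
  pC : hom (lC D) (lC D');
  pX : hom (lX D) (lX D');
  pY : hom (lY D) (lY D');
  pZ : hom (lZ D) (lZ D');
  p_a : Iso (pB ∘ la D) (la D' ∘ pA);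
  p_b : Iso (pC ∘ lb D) (lb D' ∘ pB);
  p_c : Iso (pY ∘ lc D) (lc D' ∘ pX);
  p_d : Iso (pZ ∘ ld D) (ld D' ∘ pY);
  p_f : Iso (pX ∘ lf D) (lf D' ∘ pA);
  p_g : Iso (pY ∘ lg D) (lg D' ∘ pB);
  p_h : Iso (pZ ∘ lh D) (lh D' ∘ pC);
  p_left :
    (pY ▷ lphi D) ;; assoc_l pY (lc D) (lf D)
      ;; (p_c ◁ lf D) ;; assoc_r (lc D') pX (lf D)
      ;; (lc D' ▷ p_f)
    = assoc_l pY (lg D) (la D)
      ;; (p_g ◁ la D) ;; assoc_r (lg D') pB (la D)
      ;; (lg D' ▷ p_a) ;; assoc_l (lg D') (la D') pA
      ;; (lphi D' ◁ pA) ;; assoc_r (lc D') (lf D') pA;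
  p_right :
    (pZ ▷ lpsi D) ;; assoc_l pZ (ld D) (lg D)
      ;; (p_d ◁ lg D) ;; assoc_r (ld D') pY (lg D)
      ;; (ld D' ▷ p_g)
    = assoc_l pZ (lh D) (lb D)
      ;; (p_h ◁ lb D) ;; assoc_r (lh D') pC (lb D)
      ;; (lh D' ▷ p_b) ;; assoc_l (lh D') (lb D') pB
      ;; (lpsi D' ◁ pB) ;; assoc_r (ld D') (lg D') pB
}.

Section Connecting.
Variables (L : TwoCategory) (O : L).

(* [j : Cok(f1) -> Ker(h1)] is the comparison of two short 2-exact rows
   [(a1, b1)] and [(c1, d1)] with the same middle object and verticals
   [f1], [h1], where [qf1 = coker(f1)] and [kh1 = ker(h1)]. Only [b1] and [c1]
   enter the condition that characterises [j]; the short 2-exactness of the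
   rows is not part of this predicate, since it holds automatically for the
   rows to which it is applied below. *)
Definition is_comparison (X1 Y1 C1 Q1 K1 : L) (b1 : hom Y1 C1) (c1 : hom X1 Y1)
    (qf1 : hom X1 Q1) (kh1 : hom K1 C1) (j : hom Q1 K1) : Prop :=
  is_equivalence j /\ kh1 ∘ j ∘ qf1 ≅ b1 ∘ c1.

(* All choices made in the construction for a ladder with a = ker(b) and
   d = coker(c), relative to given ker(g), ker(h), coker(f), coker(g).
   Everything is determined up to equivalence, so that the resulting 1-cell
   [special_connecting] is determined up to an invertible 2-cell. *)
Record SpecialConnectingData (A B C X Y Z : L)
    (a : hom A B) (b : hom B C) (c : hom X Y) (d : hom Y Z)
    (f : hom A X) (g : hom B Y) (h : hom C Z)
    (Kg Kh Qf Qg : L)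
    (kg : hom Kg B) (kh : hom Kh C) (qf : hom X Qf) (qg : hom Y Qg) := {
  sc_bbar : hom Kg Kh;
  sc_bbarE : kh ∘ sc_bbar ≅ b ∘ kg;
  sc_Qb : L;
  sc_qb : hom Kh sc_Qb;
  sc_qb_coker : is_cokernel O sc_bbar sc_qb;
  sc_cbar : hom Qf Qg;
  sc_cbarE : sc_cbar ∘ qf ≅ qg ∘ c;
  sc_Kc : L;
  sc_kc : hom sc_Kc Qf;
  sc_kc_ker : is_kernel O sc_cbar sc_kc;
  sc_If : L; sc_coimf : hom A sc_If; sc_imf : hom sc_If X;
  sc_f_image : normal_image O f sc_coimf sc_imf;
  sc_Ig : L; sc_coimg : hom B sc_Ig; sc_img : hom sc_Ig Y;
  sc_g_image : normal_image O g sc_coimg sc_img;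
  sc_Ih : L; sc_coimh : hom C sc_Ih; sc_imh : hom sc_Ih Z;
  sc_h_image : normal_image O h sc_coimh sc_imh;
  (* data for z1 = j1 e1 : Cok(bbar) -> Cok(ibar) -> Ker(t) *)
  sc_I : L; sc_r : hom Kg sc_I; sc_i : hom sc_I C;
  sc_i_image : normal_image O (b ∘ kg) sc_r sc_i;
  sc_ibar : hom sc_I Kh;
  sc_ibarE : kh ∘ sc_ibar ≅ sc_i;
  sc_Qi : L;
  sc_qi : hom Kh sc_Qi;
  sc_qi_coker : is_cokernel O sc_ibar sc_qi;
  sc_e1 : hom sc_Qb sc_Qi;
  sc_e1_equiv : is_equivalence sc_e1;
  sc_e1E : sc_e1 ∘ sc_qb ≅ sc_qi;
  sc_Q : L;
  sc_q : hom C sc_Q;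
  sc_q_coker : is_cokernel O sc_i sc_q;
  sc_t : hom sc_Q sc_Ih;
  sc_tE : sc_t ∘ sc_q ≅ sc_coimh;
  sc_Kt : L;
  sc_kt : hom sc_Kt sc_Q;
  sc_kt_ker : is_kernel O sc_t sc_kt;
  sc_j1 : hom sc_Qi sc_Kt;
  sc_j1_comparison : is_comparison sc_q kh sc_qi sc_kt sc_j1;
  (* data for z3 = e3 j3 : Cok(s) -> Ker(rbar) -> Ker(cbar) *)
  sc_J : L; sc_r0 : hom X sc_J; sc_j0 : hom sc_J Qg;
  sc_j0_image : normal_image O (qg ∘ c) sc_r0 sc_j0;
  sc_rbar : hom Qf sc_J;
  sc_rbarE : sc_rbar ∘ qf ≅ sc_r0;
  sc_Kr : L;
  sc_kr : hom sc_Kr Qf;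
  sc_kr_ker : is_kernel O sc_rbar sc_kr;
  sc_e3 : hom sc_Kr sc_Kc;
  sc_e3_equiv : is_equivalence sc_e3;
  sc_e3E : sc_kc ∘ sc_e3 ≅ sc_kr;
  sc_K : L;
  sc_kappa : hom sc_K X;
  sc_kappa_ker : is_kernel O sc_r0 sc_kappa;
  sc_s : hom sc_If sc_K;
  sc_sE : sc_kappa ∘ sc_s ≅ sc_imf;
  sc_Qs : L;
  sc_qs : hom sc_K sc_Qs;
  sc_qs_coker : is_cokernel O sc_s sc_qs;
  sc_j3 : hom sc_Qs sc_Kr;
  sc_j3_comparison : is_comparison qf sc_kappa sc_qs sc_kr sc_j3;
  (* data for z2 : Cok(s) -> Ker(t) and its quasi-inverse *)
  sc_ell : hom sc_If sc_Ig;
  sc_ellE : sc_ell ∘ sc_coimf ≅ sc_coimg ∘ a;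
  sc_varpi : hom sc_Ig sc_Q;
  sc_varpiE : sc_varpi ∘ sc_coimg ≅ sc_q ∘ b;
  sc_ell' : hom sc_K sc_Ig;
  sc_ell'E : sc_img ∘ sc_ell' ≅ c ∘ sc_kappa;
  sc_varpi' : hom sc_Ig sc_Ih;
  sc_varpi'E : sc_imh ∘ sc_varpi' ≅ d ∘ sc_img;
  sc_z2 : hom sc_Qs sc_Kt;
  sc_z2_comparison : is_comparison sc_varpi sc_ell' sc_qs sc_kt sc_z2;
  sc_z2inv : hom sc_Kt sc_Qs;
  sc_z2inv_quasi_inverse : quasi_inverse sc_z2 sc_z2inv
}.

Definition special_connecting (A B C X Y Z : L)
    (a : hom A B) (b : hom B C) (c : hom X Y) (d : hom Y Z)
    (f : hom A X) (g : hom B Y) (h : hom C Z)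
    (Kg Kh Qf Qg : L)
    (kg : hom Kg B) (kh : hom Kh C) (qf : hom X Qf) (qg : hom Y Qg)
    (s : SpecialConnectingData a b c d f g h kg kh qf qg) : hom Kh Qf :=
  let z1 := sc_j1 s ∘ sc_e1 s in
  let z3 := sc_e3 s ∘ sc_j3 s in
  let z := z3 ∘ sc_z2inv s ∘ z1 in
  sc_kc s ∘ z ∘ sc_qb s.

(* Reduction of a general ladder to the special one with rows [(a0, b)],
   [(c, d0)] and verticals [f0], [g], [h0]. *)
Record ConnectingData (D : Ladder L) (Kg Kh Qf Qg : L)
    (kg : hom Kg (lB D)) (kh : hom Kh (lC D))
    (qf : hom (lX D) Qf) (qg : hom (lY D) Qg) := {
  cn_Ia : L; cn_coima : hom (lA D) cn_Ia; cn_a0 : hom cn_Ia (lB D);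
  cn_a_image : normal_image O (la D) cn_coima cn_a0;
  cn_Id : L; cn_d0 : hom (lY D) cn_Id; cn_imd : hom cn_Id (lZ D);
  cn_d_image : normal_image O (ld D) cn_d0 cn_imd;
  cn_f0 : hom cn_Ia (lX D);
  cn_f0E : cn_f0 ∘ cn_coima ≅ lf D;
  cn_h0 : hom (lC D) cn_Id;
  cn_h0E : cn_imd ∘ cn_h0 ≅ lh D;
  cn_Kh0 : L;
  cn_kh0 : hom cn_Kh0 (lC D);
  cn_kh0_ker : is_kernel O cn_h0 cn_kh0;
  cn_eK : hom Kh cn_Kh0;
  cn_eK_equiv : is_equivalence cn_eK;
  cn_eKE : cn_kh0 ∘ cn_eK ≅ kh;
  cn_Qf0 : L;
  cn_qf0 : hom (lX D) cn_Qf0;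
  cn_qf0_coker : is_cokernel O cn_f0 cn_qf0;
  cn_eQ : hom cn_Qf0 Qf;
  cn_eQ_equiv : is_equivalence cn_eQ;
  cn_eQE : cn_eQ ∘ cn_qf0 ≅ qf;
  cn_special : SpecialConnectingData cn_a0 (lb D) (lc D) cn_d0
    cn_f0 (lg D) cn_h0 kg cn_kh0 cn_qf0 qg
}.

Definition is_connecting (D : Ladder L) (Kg Kh Qf Qg : L)
    (kg : hom Kg (lB D)) (kh : hom Kh (lC D))
    (qf : hom (lX D) Qf) (qg : hom (lY D) Qg) (del : hom Kh Qf) : Prop :=
  exists s : ConnectingData kg kh qf qg,
    del ≅ cn_eQ s ∘ special_connecting (cn_special s) ∘ cn_eK s.

(* A snake sequence of [D]: a choice of 2-kernels and 2-cokernels of the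
   verticals and of the 1-cells between them. *)
Record SnakeSequence (D : Ladder L) := {
  Kf : L; kf : hom Kf (lA D); kf_ker : is_kernel O (lf D) kf;
  Kg : L; kg : hom Kg (lB D); kg_ker : is_kernel O (lg D) kg;
  Kh : L; kh : hom Kh (lC D); kh_ker : is_kernel O (lh D) kh;
  Qf : L; qf : hom (lX D) Qf; qf_coker : is_cokernel O (lf D) qf;
  Qg : L; qg : hom (lY D) Qg; qg_coker : is_cokernel O (lg D) qg;
  Qh : L; qh : hom (lZ D) Qh; qh_coker : is_cokernel O (lh D) qh;
  s_a : hom Kf Kg;
  s_aE : kg ∘ s_a ≅ la D ∘ kf;
  s_b : hom Kg Kh;
  s_bE : kh ∘ s_b ≅ lb D ∘ kg;
  s_del : hom Kh Qf;
  s_delE : is_connecting kg kh qf qg s_del;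
  s_c : hom Qf Qg;
  s_cE : s_c ∘ qf ≅ qg ∘ lc D;
  s_d : hom Qg Qh;
  s_dE : s_d ∘ qg ≅ qh ∘ ld D
}.

Record InducedCells (D D' : Ladder L) (p : LadderMorphism D D')
    (S : SnakeSequence D) (S' : SnakeSequence D') := {
  iA : hom (Kf S) (Kf S');
  iAE : kf S' ∘ iA ≅ pA p ∘ kf S;
  iB : hom (Kg S) (Kg S');
  iBE : kg S' ∘ iB ≅ pB p ∘ kg S;
  iC : hom (Kh S) (Kh S');
  iCE : kh S' ∘ iC ≅ pC p ∘ kh S;
  iX : hom (Qf S) (Qf S');
  iXE : iX ∘ qf S ≅ qf S' ∘ pX p;
  iY : hom (Qg S) (Qg S');
  iYE : iY ∘ qg S ≅ qg S' ∘ pY p;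
  iZ : hom (Qh S) (Qh S');
  iZE : iZ ∘ qh S ≅ qh S' ∘ pZ p
}.

End Connecting.

(* Main.v *)
Require Import Defs.
From Stdlib Require Import Setoid Morphisms.

Set Implicit Arguments.
Unset Strict Implicit.
Unset Printing Implicit Defensive.

(** Only the existence of invertible 2-cells is asserted, so the whole argument
    takes place among 1-cells up to isomorphism. Up to isomorphism a 2-kernel
    is an ordinary kernel and a 2-cokernel an ordinary cokernel: the lifting
    property for 2-cells shows that 2-kernels can be cancelled on the left and
    2-cokernels on the right ([kernel_cancel], [cokernel_cancel]), and by
    strongness of the bizero object all parallel null 1-cells are isomorphic,
    so that normal 2-monomorphisms reflect null 1-cells ([normal_mono_zero]).

    Consequently 2-kernels, 2-cokernels and normal image factorisations are
    functorial on squares commuting up to isomorphism ([kernel_map],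
    [cokernel_map], [image_map]). Every object entering the construction of the
    connecting 1-cell is obtained from the ladder by these three operations, so
    a morphism of ladders acts on all of them. The comparisons z1, z2, z3 have
    the form Cok -> Ker and are determined by their composites with a
    2-cokernel before and a 2-kernel after; they therefore commute with the
    induced 1-cells as soon as these composites do ([comparison_natural]), which
    is a matter of pasting squares. A quasi-inverse of z2 is then natural as
    well, and pasting all pieces gives the naturality of the connecting 1-cell
    for special ladders ([special_connecting_natural]). The reduction of a
    general ladder to a special one is again made of normal image
    factorisations, 2-kernels and 2-cokernels ([connecting_natural]). *)

(** * One-cells up to isomorphism *)

#[local] Instance isomorphic_equivalence (C : Category) :
  Equivalence (@isomorphic C).
Proof.
  split.
  - intros x; exists (idarr x), (idarr x); split; apply then_id_l.
  - intros x y (u & v & uv & vu); exists v, u; split; assumption.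
  - intros x y z (u & u' & uu' & u'u) (v & v' & vv' & v'v).
    exists (u ;; v), (v' ;; u'); split.
    + rewrite then_assoc, <- (then_assoc u), vv', then_id_r; exact uu'.
    + rewrite then_assoc, <- (then_assoc v'), u'u, then_id_r; exact v'v.
Qed.

Lemma isomorphic_sym (C : Category) (x y : C) : x ≅ y -> y ≅ x.
Proof. intros e; symmetry; exact e. Qed.

#[local] Instance comp1_proper (L : TwoCategory) (A B C : L) :
  Proper (@isomorphic (hom B C) ==> @isomorphic (hom A B) ==>
          @isomorphic (hom A C)) (@comp1 L A B C).
Proof.
  intros g g' (be & be' & b1 & b2) f f' (al & al' & a1 & a2).
  exists (hcomp be al), (hcomp be' al').
  split; rewrite <- interchange, ?b1, ?b2, ?a1, ?a2; apply hcomp_idarr.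
Qed.

(** Extension of an isomorphism of composites to a right-associated composite
    of which it is an initial segment. *)
Lemma extend_composite (L : TwoCategory) (A B C D E : L)
    (x : hom B D) (y : hom A B) (x' : hom C D) (y' : hom A C) :
  x ∘ y ≅ x' ∘ y' ->
  forall w : hom E A, x ∘ y ∘ w ≅ x' ∘ y' ∘ w.
Proof. intros e w; rewrite 2!comp1_assoc, e; reflexivity. Qed.

Lemma extend_composite1 (L : TwoCategory) (A B D E : L)
    (x : hom B D) (y : hom A B) (z : hom A D) :
  x ∘ y ≅ z -> forall w : hom E A, x ∘ y ∘ w ≅ z ∘ w.
Proof. intros e w; rewrite comp1_assoc, e; reflexivity. Qed.

(* Rewriting with an isomorphism of composites at the end of, or inside, a
   right-associated composite. *)
Tactic Notation "chase" constr(e) :=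
  first [ rewrite (extend_composite e) | rewrite (extend_composite1 e)
        | rewrite e ];
  rewrite <- ?comp1_assoc.
Tactic Notation "chase" "<-" constr(e) :=
  let e' := constr:(isomorphic_sym e) in chase e'.

Lemma quasi_inverse_natural (L : TwoCategory) (A B A' B' : L)
    (z : hom A B) (y : hom B A) (z' : hom A' B') (y' : hom B' A')
    (u : hom A A') (v : hom B B') :
  quasi_inverse z y -> quasi_inverse z' y' ->
  v ∘ z ≅ z' ∘ u -> u ∘ y ≅ y' ∘ v.
Proof.
  intros [zy _] [_ yz'] sq.
  rewrite <- (comp1_id_l (u ∘ y)), <- yz', <- comp1_assoc.
  chase <- sq. rewrite zy, comp1_id_r. reflexivity.
Qed.

(** * Two-kernels, two-cokernels and normal images *)

Section Exactness.
Variables (L : TwoCategory) (O : L).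

Lemma kernel_cancel (A B K : L) (f : hom A B) (k : hom K A) :
  is_kernel O f k ->
  forall (Z : L) (u v : hom Z K), k ∘ u ≅ k ∘ v -> u ≅ v.
Proof.
  intros hk Z u v (al & be & ab & ba).
  destruct (kernel_lift2 hk al) as (mu & mu_al & _).
  destruct (kernel_lift2 hk be) as (nu & nu_be & _).
  assert (inj : forall (w : hom Z K) (x : arr w w),
             k ▷ x = idarr (k ∘ w) -> x = idarr w).
  { intros w x hx. destruct (kernel_lift2 hk (idarr (k ∘ w))) as (y & _ & uq).
    rewrite <- (uq x hx). apply uq, hcomp_idarr. }
  exists mu, nu; split; apply inj;
    rewrite <- (then_id_l (idarr k)), interchange, mu_al, nu_be; assumption.
Qed.

Lemma cokernel_cancel (A B Q : L) (f : hom A B) (q : hom B Q) :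
  is_cokernel O f q ->
  forall (Z : L) (u v : hom Q Z), u ∘ q ≅ v ∘ q -> u ≅ v.
Proof.
  intros hq Z u v (al & be & ab & ba).
  destruct (cokernel_desc2 hq al) as (mu & mu_al & _).
  destruct (cokernel_desc2 hq be) as (nu & nu_be & _).
  assert (inj : forall (w : hom Q Z) (x : arr w w),
             x ◁ q = idarr (w ∘ q) -> x = idarr w).
  { intros w x hx. destruct (cokernel_desc2 hq (idarr (w ∘ q))) as (y & _ & uq).
    rewrite <- (uq x hx). apply uq, hcomp_idarr. }
  exists mu, nu; split; apply inj;
    rewrite <- (then_id_l (idarr q)), interchange, mu_al, nu_be; assumption.
Qed.

Lemma normal_mono_cancel (A K : L) (m : hom K A) :
  normal_mono O m ->
  forall (Z : L) (u v : hom Z K), m ∘ u ≅ m ∘ v -> u ≅ v.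
Proof. intros (B & f & hm); exact (kernel_cancel hm). Qed.

Lemma normal_epi_cancel (B Q : L) (e : hom B Q) :
  normal_epi O e ->
  forall (Z : L) (u v : hom Q Z), u ∘ e ≅ v ∘ e -> u ≅ v.
Proof. intros (A & f & he); exact (cokernel_cancel he). Qed.

#[local] Instance is_zero_proper (A B : L) :
  Proper (@isomorphic (hom A B) ==> iff) (@is_zero L O A B).
Proof.
  intros f g e; split; intros (n & hn & fn); exists n; split; trivial.
  - rewrite <- e; exact fn.
  - rewrite e; exact fn.
Qed.

Lemma is_zero_postcomp (A B C : L) (f : hom A B) (g : hom B C) :
  is_zero O f -> is_zero O (g ∘ f).
Proof.
  intros (n & (u & v & ->) & e). exists (g ∘ v ∘ u); split.
  - exists u, (g ∘ v); apply comp1_assoc.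
  - rewrite e; reflexivity.
Qed.

Lemma is_zero_precomp (A B C : L) (f : hom A B) (g : hom B C) :
  is_zero O g -> is_zero O (g ∘ f).
Proof.
  intros (n & (u & v & ->) & e). exists (v ∘ u ∘ f); split.
  - exists (u ∘ f), v; reflexivity.
  - rewrite e, <- comp1_assoc; reflexivity.
Qed.

Lemma kernel_map (A B A' B' K K' : L) (f : hom A B) (f' : hom A' B')
    (k : hom K A) (k' : hom K' A') (u : hom A A') (v : hom B B') :
  is_kernel O f k -> is_kernel O f' k' -> v ∘ f ≅ f' ∘ u ->
  exists w : hom K K', k' ∘ w ≅ u ∘ k.
Proof.
  intros hk hk' sq. apply (kernel_lift hk').
  rewrite comp1_assoc, <- sq, <- comp1_assoc.
  apply is_zero_postcomp, (kernel_zero hk).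
Qed.

Lemma cokernel_map (A B A' B' Q Q' : L) (f : hom A B) (f' : hom A' B')
    (q : hom B Q) (q' : hom B' Q') (u : hom A A') (v : hom B B') :
  is_cokernel O f q -> is_cokernel O f' q' -> v ∘ f ≅ f' ∘ u ->
  exists w : hom Q Q', w ∘ q ≅ q' ∘ v.
Proof.
  intros hq hq' sq. apply (cokernel_desc hq).
  rewrite <- comp1_assoc, sq, comp1_assoc.
  apply is_zero_precomp, (cokernel_zero hq').
Qed.

(** A 1-cell of the form Cok -> Ker is determined by its composite with the
    2-cokernel and the 2-kernel, so its naturality can be tested there. *)
Lemma comparison_natural (A B Q C K B' Q' C' D' K' : L)
    (s : hom A B) (qs : hom B Q) (kt : hom K C)
    (qs' : hom B' Q') (t' : hom C' D') (kt' : hom K' C')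
    (z : hom Q K) (z' : hom Q' K') (m : hom B C) (m' : hom B' C')
    (pB : hom B B') (pQ : hom Q Q') (pK : hom K K') (pC : hom C C') :
  is_cokernel O s qs -> is_kernel O t' kt' ->
  kt ∘ z ∘ qs ≅ m -> kt' ∘ z' ∘ qs' ≅ m' ->
  pQ ∘ qs ≅ qs' ∘ pB -> kt' ∘ pK ≅ pC ∘ kt ->
  pC ∘ m ≅ m' ∘ pB -> pK ∘ z ≅ z' ∘ pQ.
Proof.
  intros hqs hkt' zE z'E sQ sK sm.
  apply (cokernel_cancel hqs), (kernel_cancel hkt').
  rewrite <- ?comp1_assoc, sQ.
  chase sK. rewrite zE, sm, <- z'E, <- ?comp1_assoc. reflexivity.
Qed.

Hypothesis hO : is_bizero O.
Hypothesis hS : is_strong O.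

Lemma null_isomorphic (A B : L) (f g : hom A B) :
  is_null O f -> is_null O g -> f ≅ g.
Proof.
  intros hf hg.
  destruct (hS hf hg) as (al & _), (hS hg hf) as (be & _).
  assert (inj : forall (w : hom A B) (x : arr w w), is_null O w -> x = idarr w).
  { intros w x hw. destruct (hS hw hw) as (y & _ & uq).
    rewrite <- (uq x I). apply uq; exact I. }
  exists al, be; split; apply inj; assumption.
Qed.

Lemma normal_mono_zero (A K Z : L) (m : hom K A) (x : hom Z K) :
  normal_mono O m -> is_zero O (m ∘ x) -> is_zero O x.
Proof.
  intros hm (n & hn & e).
  destruct hn as (u & v & ->).
  destruct (proj2 (hO K)) as (_ & G & _).
  (* [G tt] is a 1-cell from the bizero object to [K]. *)
  exists (G tt ∘ u); split; [now exists u, (G tt) |].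
  apply (normal_mono_cancel hm). rewrite e.
  apply null_isomorphic.
  - now exists u, v.
  - exists u, (m ∘ G tt); apply comp1_assoc.
Qed.

(** Normal image factorisations are functorial: the coimage, being a
    2-cokernel, receives the 1-cell, and the image square then follows by
    cancelling the coimage. *)
Lemma image_map (A B A' B' J J' : L) (f : hom A B) (f' : hom A' B')
    (e : hom A J) (m : hom J B) (e' : hom A' J') (m' : hom J' B')
    (u : hom A A') (v : hom B B') :
  normal_image O f e m -> normal_image O f' e' m' -> v ∘ f ≅ f' ∘ u ->
  exists w : hom J J', w ∘ e ≅ e' ∘ u /\ m' ∘ w ≅ v ∘ m.
Proof.
  intros (he & hm & fE) (he' & hm' & f'E) sq.
  assert (sq' : m' ∘ e' ∘ u ≅ v ∘ m ∘ e).
  { rewrite <- fE, sq, f'E, <- comp1_assoc; reflexivity. }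
  assert (he1 := he). destruct he1 as (X & x & hx).
  destruct (cokernel_desc hx (z := e' ∘ u)) as (w & wE).
  - apply (normal_mono_zero hm').
    rewrite (extend_composite1 sq'), <- ?comp1_assoc.
    do 2 apply is_zero_postcomp. exact (cokernel_zero hx).
  - exists w; split; [exact wE |].
    apply (normal_epi_cancel he). rewrite <- ?comp1_assoc, wE. exact sq'.
Qed.

End Exactness.

(** * Naturality of the connecting 1-cell *)

Section Naturality.
Variables (L : TwoCategory) (O : L).
Hypothesis hO : is_bizero O.
Hypothesis hS : is_strong O.

(** The 1-cells on the outer 2-kernels and 2-cokernels are given; those on the
    inner objects of the construction are induced step by step. *)
Lemma special_connecting_natural
    (A B C X Y Z A' B' C' X' Y' Z' Kg Kh Qf Qg Kg' Kh' Qf' Qg' : L)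
    (a : hom A B) (b : hom B C) (c : hom X Y) (d : hom Y Z)
    (f : hom A X) (g : hom B Y) (h : hom C Z)
    (a' : hom A' B') (b' : hom B' C') (c' : hom X' Y') (d' : hom Y' Z')
    (f' : hom A' X') (g' : hom B' Y') (h' : hom C' Z')
    (kg : hom Kg B) (kh : hom Kh C) (qf : hom X Qf) (qg : hom Y Qg)
    (kg' : hom Kg' B') (kh' : hom Kh' C')
    (qf' : hom X' Qf') (qg' : hom Y' Qg')
    (s : SpecialConnectingData O a b c d f g h kg kh qf qg)
    (s' : SpecialConnectingData O a' b' c' d' f' g' h' kg' kh' qf' qg')
    (pA : hom A A') (pB : hom B B') (pC : hom C C')
    (pX : hom X X') (pY : hom Y Y') (pZ : hom Z Z')
    (pKg : hom Kg Kg') (pKh : hom Kh Kh') (pQf : hom Qf Qf') (pQg : hom Qg Qg') :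
  is_kernel O h' kh' -> is_cokernel O f qf ->
  pC ∘ b ≅ b' ∘ pB -> pY ∘ c ≅ c' ∘ pX ->
  pX ∘ f ≅ f' ∘ pA -> pY ∘ g ≅ g' ∘ pB -> pZ ∘ h ≅ h' ∘ pC ->
  kg' ∘ pKg ≅ pB ∘ kg -> kh' ∘ pKh ≅ pC ∘ kh ->
  pQf ∘ qf ≅ qf' ∘ pX -> pQg ∘ qg ≅ qg' ∘ pY ->
  pQf ∘ special_connecting s ≅ special_connecting s' ∘ pKh.
Proof.
  intros hkh' hqf sb sc sf sg sh skg skh sqf sqg.
  assert (sbbar : pKh ∘ sc_bbar s ≅ sc_bbar s' ∘ pKg).
  { apply (kernel_cancel hkh'). chase skh. chase (sc_bbarE s).
    chase sb. chase (sc_bbarE s'). chase skg. reflexivity. }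
  assert (scbar : pQg ∘ sc_cbar s ≅ sc_cbar s' ∘ pQf).
  { apply (cokernel_cancel hqf). rewrite <- ?comp1_assoc.
    chase (sc_cbarE s). chase sqg. chase sc.
    chase sqf. chase (sc_cbarE s'). reflexivity. }
  destruct (cokernel_map (sc_qb_coker s) (sc_qb_coker s') sbbar)
    as (pQb & sqb).
  destruct (kernel_map (sc_kc_ker s) (sc_kc_ker s') scbar) as (pKc & skc).
  destruct (image_map hO hS (sc_f_image s) (sc_f_image s') sf)
    as (pIf & _ & simf).
  destruct (image_map hO hS (sc_g_image s) (sc_g_image s') sg)
    as (pIg & scoimg & simg).
  destruct (image_map hO hS (sc_h_image s) (sc_h_image s') sh)
    as (pIh & scoimh & _).
  assert (sbk : pC ∘ b ∘ kg ≅ (b' ∘ kg') ∘ pKg).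
  { rewrite <- comp1_assoc. chase sb. chase skg. reflexivity. }
  destruct (image_map hO hS (sc_i_image s) (sc_i_image s') sbk)
    as (pI & _ & si).
  assert (scq : pQg ∘ qg ∘ c ≅ (qg' ∘ c') ∘ pX).
  { rewrite <- comp1_assoc. chase sqg. chase sc. reflexivity. }
  destruct (image_map hO hS (sc_j0_image s) (sc_j0_image s') scq)
    as (pJ & sr0 & _).
  destruct (cokernel_map (sc_q_coker s) (sc_q_coker s') (symmetry si))
    as (pQ & sq).
  destruct (kernel_map (sc_kappa_ker s) (sc_kappa_ker s') sr0)
    as (pK & skappa).
  assert (st : pIh ∘ sc_t s ≅ sc_t s' ∘ pQ).
  { apply (cokernel_cancel (sc_q_coker s)). rewrite <- ?comp1_assoc.
    chase (sc_tE s). chase scoimh. chase sq. chase (sc_tE s'). reflexivity. }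
  assert (ss : pK ∘ sc_s s ≅ sc_s s' ∘ pIf).
  { apply (kernel_cancel (sc_kappa_ker s')). chase skappa. chase (sc_sE s).
    chase (sc_sE s'). symmetry; exact simf. }
  destruct (kernel_map (sc_kt_ker s) (sc_kt_ker s') st) as (pKt & skt).
  destruct (cokernel_map (sc_qs_coker s) (sc_qs_coker s') ss) as (pQs & sqs).
  (* naturality of z1, tested on [kh] followed by [q] *)
  assert (z1E : sc_kt s ∘ (sc_j1 s ∘ sc_e1 s) ∘ sc_qb s ≅ sc_q s ∘ kh).
  { rewrite <- ?comp1_assoc. chase (sc_e1E s).
    exact (proj2 (sc_j1_comparison s)). }
  assert (z1E' : sc_kt s' ∘ (sc_j1 s' ∘ sc_e1 s') ∘ sc_qb s' ≅ sc_q s' ∘ kh').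
  { rewrite <- ?comp1_assoc. chase (sc_e1E s').
    exact (proj2 (sc_j1_comparison s')). }
  assert (sz1 : pKt ∘ sc_j1 s ∘ sc_e1 s ≅ (sc_j1 s' ∘ sc_e1 s') ∘ pQb).
  { apply (comparison_natural (sc_qb_coker s) (sc_kt_ker s') z1E z1E' sqb skt).
    rewrite <- ?comp1_assoc. chase sq. chase skh. reflexivity. }
  (* naturality of z3, tested on [kappa] followed by [qf] *)
  assert (z3E : sc_kc s ∘ (sc_e3 s ∘ sc_j3 s) ∘ sc_qs s ≅ qf ∘ sc_kappa s).
  { rewrite <- ?comp1_assoc. chase (sc_e3E s).
    exact (proj2 (sc_j3_comparison s)). }
  assert (z3E' : sc_kc s' ∘ (sc_e3 s' ∘ sc_j3 s') ∘ sc_qs s'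
                 ≅ qf' ∘ sc_kappa s').
  { rewrite <- ?comp1_assoc. chase (sc_e3E s').
    exact (proj2 (sc_j3_comparison s')). }
  assert (sz3 : pKc ∘ sc_e3 s ∘ sc_j3 s ≅ (sc_e3 s' ∘ sc_j3 s') ∘ pQs).
  { apply (comparison_natural (sc_qs_coker s) (sc_kc_ker s') z3E z3E' sqs skc).
    rewrite <- ?comp1_assoc. chase sqf. chase skappa. reflexivity. }
  (* naturality of z2, tested on [ell'] followed by [varpi] *)
  assert (svarpi : pQ ∘ sc_varpi s ≅ sc_varpi s' ∘ pIg).
  { apply (normal_epi_cancel (proj1 (sc_g_image s))). rewrite <- ?comp1_assoc.
    chase (sc_varpiE s). chase sq. chase sb. chase scoimg.
    chase (sc_varpiE s'). reflexivity. }
  assert (sell' : pIg ∘ sc_ell' s ≅ sc_ell' s' ∘ pK).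
  { apply (normal_mono_cancel (proj1 (proj2 (sc_g_image s')))).
    chase simg. chase (sc_ell'E s). chase sc. chase (sc_ell'E s').
    chase skappa. reflexivity. }
  assert (sz2 : pKt ∘ sc_z2 s ≅ sc_z2 s' ∘ pQs).
  { apply (comparison_natural (sc_qs_coker s) (sc_kt_ker s')
             (proj2 (sc_z2_comparison s)) (proj2 (sc_z2_comparison s'))
             sqs skt).
    chase svarpi. chase sell'. reflexivity. }
  assert (sz2inv := quasi_inverse_natural (sc_z2inv_quasi_inverse s)
                      (sc_z2inv_quasi_inverse s') sz2).
  clear z1E z1E' z3E z3E'.
  unfold special_connecting; cbv zeta; revert sz1 sz3.
  generalize (sc_j1 s ∘ sc_e1 s), (sc_j1 s' ∘ sc_e1 s'),
    (sc_e3 s ∘ sc_j3 s), (sc_e3 s' ∘ sc_j3 s'); intros z1 z1' z3 z3' sz1 sz3.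
  rewrite <- ?comp1_assoc.
  chase <- skc. chase sz3. chase sz2inv. chase sz1. chase sqb.
  reflexivity.
Qed.

Lemma connecting_natural (D D' : Ladder L) (p : LadderMorphism D D')
    (Kg Kh Qf Qg Kg' Kh' Qf' Qg' : L)
    (kg : hom Kg (lB D)) (kh : hom Kh (lC D))
    (qf : hom (lX D) Qf) (qg : hom (lY D) Qg)
    (kg' : hom Kg' (lB D')) (kh' : hom Kh' (lC D'))
    (qf' : hom (lX D') Qf') (qg' : hom (lY D') Qg')
    (del : hom Kh Qf) (del' : hom Kh' Qf')
    (pKg : hom Kg Kg') (pKh : hom Kh Kh') (pQf : hom Qf Qf') (pQg : hom Qg Qg') :
  is_connecting O kg kh qf qg del -> is_connecting O kg' kh' qf' qg' del' ->
  kg' ∘ pKg ≅ pB p ∘ kg -> kh' ∘ pKh ≅ pC p ∘ kh ->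
  pQf ∘ qf ≅ qf' ∘ pX p -> pQg ∘ qg ≅ qg' ∘ pY p ->
  pQf ∘ del ≅ del' ∘ pKh.
Proof.
  intros [s delE] [s' del'E] skg skh sqf sqg.
  assert (sa : pB p ∘ la D ≅ la D' ∘ pA p) by (eexists; apply (p_a p)).
  assert (sb : pC p ∘ lb D ≅ lb D' ∘ pB p) by (eexists; apply (p_b p)).
  assert (sc : pY p ∘ lc D ≅ lc D' ∘ pX p) by (eexists; apply (p_c p)).
  assert (sd : pZ p ∘ ld D ≅ ld D' ∘ pY p) by (eexists; apply (p_d p)).
  assert (sf : pX p ∘ lf D ≅ lf D' ∘ pA p) by (eexists; apply (p_f p)).
  assert (sg : pY p ∘ lg D ≅ lg D' ∘ pB p) by (eexists; apply (p_g p)).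
  assert (sh : pZ p ∘ lh D ≅ lh D' ∘ pC p) by (eexists; apply (p_h p)).
  destruct (image_map hO hS (cn_a_image s) (cn_a_image s') sa)
    as (pIa & scoima & _).
  destruct (image_map hO hS (cn_d_image s) (cn_d_image s') sd)
    as (pId & _ & simd).
  assert (sf0 : pX p ∘ cn_f0 s ≅ cn_f0 s' ∘ pIa).
  { apply (normal_epi_cancel (proj1 (cn_a_image s))). rewrite <- ?comp1_assoc.
    chase (cn_f0E s). chase sf. chase scoima. chase (cn_f0E s'). reflexivity. }
  assert (sh0 : pId ∘ cn_h0 s ≅ cn_h0 s' ∘ pC p).
  { apply (normal_mono_cancel (proj1 (proj2 (cn_d_image s')))).
    chase simd. chase (cn_h0E s). chase sh. chase (cn_h0E s'). reflexivity. }
  destruct (kernel_map (cn_kh0_ker s) (cn_kh0_ker s') sh0) as (pKh0 & skh0).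
  destruct (cokernel_map (cn_qf0_coker s) (cn_qf0_coker s') sf0)
    as (pQf0 & sqf0).
  assert (seK : pKh0 ∘ cn_eK s ≅ cn_eK s' ∘ pKh).
  { apply (kernel_cancel (cn_kh0_ker s')). chase skh0. chase (cn_eKE s).
    chase (cn_eKE s'). symmetry; exact skh. }
  assert (seQ : pQf ∘ cn_eQ s ≅ cn_eQ s' ∘ pQf0).
  { apply (cokernel_cancel (cn_qf0_coker s)). rewrite <- ?comp1_assoc.
    chase (cn_eQE s). chase sqf0. chase (cn_eQE s'). exact sqf. }
  assert (sspec := special_connecting_natural (cn_special s) (cn_special s')
    (cn_kh0_ker s') (cn_qf0_coker s) sb sc sf0 sg sh0 skg skh0 sqf0 sqg).
  rewrite delE, del'E, <- ?comp1_assoc.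
  chase seQ. chase sspec. chase seK. reflexivity.
Qed.

End Naturality.

Theorem theorem7p10 (L : TwoCategory) (O : L) (hL : two_di_exact O)
    (D D' : Ladder L) (hD : exact_ladder O D) (hD' : exact_ladder O D')
    (p : LadderMorphism D D')
    (S : SnakeSequence O D) (S' : SnakeSequence O D') :
  inhabited (InducedCells p S S') /\
  forall P : InducedCells p S S',
    iB P ∘ s_a S ≅ s_a S' ∘ iA P /\
    iC P ∘ s_b S ≅ s_b S' ∘ iB P /\
    iX P ∘ s_del S ≅ s_del S' ∘ iC P /\
    iY P ∘ s_c S ≅ s_c S' ∘ iX P /\
    iZ P ∘ s_d S ≅ s_d S' ∘ iY P.
Proof.
  assert (sa : pB p ∘ la D ≅ la D' ∘ pA p) by (eexists; apply (p_a p)).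
  assert (sb : pC p ∘ lb D ≅ lb D' ∘ pB p) by (eexists; apply (p_b p)).
  assert (sc : pY p ∘ lc D ≅ lc D' ∘ pX p) by (eexists; apply (p_c p)).
  assert (sd : pZ p ∘ ld D ≅ ld D' ∘ pY p) by (eexists; apply (p_d p)).
  assert (sf : pX p ∘ lf D ≅ lf D' ∘ pA p) by (eexists; apply (p_f p)).
  assert (sg : pY p ∘ lg D ≅ lg D' ∘ pB p) by (eexists; apply (p_g p)).
  assert (sh : pZ p ∘ lh D ≅ lh D' ∘ pC p) by (eexists; apply (p_h p)).
  split.
  - destruct (kernel_map (kf_ker S) (kf_ker S') sf) as (uA & eA).
    destruct (kernel_map (kg_ker S) (kg_ker S') sg) as (uB & eB).
    destruct (kernel_map (kh_ker S) (kh_ker S') sh) as (uC & eC).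
    destruct (cokernel_map (qf_coker S) (qf_coker S') sf) as (uX & eX).
    destruct (cokernel_map (qg_coker S) (qg_coker S') sg) as (uY & eY).
    destruct (cokernel_map (qh_coker S) (qh_coker S') sh) as (uZ & eZ).
    constructor; econstructor; eassumption.
  - intros P; repeat split.
    + apply (kernel_cancel (kg_ker S')). chase (iBE P). chase (s_aE S).
      chase sa. chase (s_aE S'). chase (iAE P). reflexivity.
    + apply (kernel_cancel (kh_ker S')). chase (iCE P). chase (s_bE S).
      chase sb. chase (s_bE S'). chase (iBE P). reflexivity.
    + exact (connecting_natural (bizero hL) (bizero_strong hL)
        (s_delE S) (s_delE S') (iBE P) (iCE P) (iXE P) (iYE P)).
    + apply (cokernel_cancel (qf_coker S)). rewrite <- ?comp1_assoc.
      chase (s_cE S). chase (iYE P). chase sc. chase (iXE P).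
      chase (s_cE S'). reflexivity.
    + apply (cokernel_cancel (qg_coker S)). rewrite <- ?comp1_assoc.
      chase (s_dE S). chase (iZE P). chase sd. chase (iYE P).
      chase (s_dE S'). reflexivity.
Qed.
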